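(* Let $k>t\ge 1$, put $m_k=\binom{k+1}{2}$ and $c_t=2(t+2)^{2t}(2t)!$, and suppose that $$n+1-k\ge c_t(m_k+1).$$ If $\mathcal A\subseteq\mathcal F_k(M_n)$ is $t$-intersecting, then $$|\mathcal A|\le\genfrac{[}{]}{0pt}{}{n-t}{k-t}.$$ Equality holds if and only if there is a rank-$t$ flat $T$ of $M_n$ such that $\mathcal A=\{A\in\mathcal F_k(M_n):T\le A\}$.
   Context: Let $\Omega_n=\{0,1,\dots,n\}$ and let $M_n=M(K_{n+1})$ be the graphic matroid of the complete graph on vertex set $\Omega_n$. Its lattice of flats, ordered by inclusion, is identified with the lattice of set partitions of $\Omega_n$ ordered by refinement (finer $\le$ coarser): the partition $\pi$ corresponds to the flat that is the union of the edge sets of the complete graphs on the blocks of $\pi$, and this flat has rank $\operatorname{rk}=n+1-|\pi|$, where $|\pi|$ is the number of blocks. Meet $\wedge$ is set intersection of flats (common refinement of partitions). $\mathcal F_k(M_n)$ is the set of rank-$k$ flats, i.e. partitions of $\Omega_n$ into $n+1-k$ nonempty blocks. A nonempty family $\mathcal A\subseteq \mathcal F_k(M_n)$ is $t$-intersecting if $\operatorname{rk}(A\wedge B)\ge t$ for all $A,B\in\mathcal A$. Families called $t$-intersecting are always assumed nonempty. For $0\le y\le x$, $\genfrac{[}{]}{0pt}{}{x}{y}:=S(x+1,x+1-y)$, where $S(N,b)$ is the Stirling number of the second kind (number of partitions of an $N$-set into $b$ nonempty blocks). *)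

(* Defs.v *)
From mathcomp Require Import all_boot.

Set Implicit Arguments.
Unset Strict Implicit.
Unset Printing Implicit Defensive.

(* A matroid on the ground set E is given by its independent sets. *)
Definition mrank (E : finType) (indep : pred {set E}) (X : {set E}) : nat :=
  \max_(I : {set E} | (I \subset X) && indep I) #|I|.

Definition is_flat (E : finType) (indep : pred {set E}) (F : {set E}) : bool :=
  [forall e, (e \notin F) ==> (mrank indep F < mrank indep (e |: F))].

(* Ground set of the graphic matroid M(K_{n+1}); the vertex set {0, ..., n} is
   'I_n.+1. *)
Notation edge n := {e : {set 'I_n.+1} | #|e| == 2}.

Definition adj (n : nat) (I : {set edge n}) : rel 'I_n.+1 :=
  fun u v => [exists e in I, val e == [set u; v]].

(* The independent sets of M(K_{n+1}): edge sets containing no cycle. A cycle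
   is a sequence of at least 3 distinct vertices, hence of length at most
   n.+1, with cyclically consecutive vertices adjacent. *)
Definition forest (n : nat) : pred {set edge n} :=
  fun I => [forall m : 'I_n.+2, forall c : m.-tuple 'I_n.+1,
              (2 < m) ==> ~~ ucycleb (adj I) c].

Definition rk (n : nat) (X : {set edge n}) : nat := mrank (@forest n) X.

Definition flats (n k : nat) : {set {set edge n}} :=
  [set F | is_flat (@forest n) F & rk F == k].

(* The meet of two flats is their intersection. *)
Definition t_intersecting (n t : nat) (A : {set {set edge n}}) : Prop :=
  A != set0 /\ {in A &, forall F G : {set edge n}, t <= rk (F :&: G)}.

Definition stirling2 (N b : nat) : nat :=
  #|[set P : {set {set 'I_N}} | partition P [set: 'I_N] & #|P| == b]|.

Definition bracket (x y : nat) : nat := stirling2 x.+1 (x.+1 - y).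

Definition m_ (k : nat) : nat := 'C(k.+1, 2).

Definition c_ (t : nat) : nat := 2 * (t + 2) ^ (2 * t) * (2 * t)`!.

(* Main.v *)
(* The rank of an edge set is n + 1 minus its number of components, so the flats
   are the kernels of maps on the vertices, and the rank-k flats above a rank-s
   flat correspond to the partitions of its n + 1 - s blocks into b = n + 1 - k
   parts. Call this number W_s; joining one more point to a block gives
   b W_(s+1) <= W_s.

   Among the t-intersecting families of flats of rank at most k such that every
   member of A contains one of them, let G minimise the sum of the ranks. If G
   has a member of rank t, all of A contains it. Otherwise put r = k ^ 2 + 1,
   which exceeds the size of every flat of rank at most k. For T of rank t, G has
   at most r ^ (s - t) members of rank s above T: if it had more, a flat S above T
   of rank below s maximising r ^ rk S times the number of such members above S
   would satisfy rk (S :&: B) >= t for all B in G, and could replace the members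
   above it. Letting T run over the rank-t flats below a member of G of least rank
   q > t, at most (q ^ 2) ^ t in number, and summing W_s <= b ^ -(s - t) W_t over
   G gives #|A| < W_t, because b is large compared with r. *)
Require Import Defs.
From mathcomp Require Import all_boot zify.

Set Implicit Arguments.
Unset Strict Implicit.
Unset Printing Implicit Defensive.

(** * Kernels of maps, set partitions and Stirling numbers *)

Lemma leq_card_imset_ker (U A B : finType) (f : U -> A) (g : U -> B) :
  (forall u v, f u = f v -> g u = g v) -> #|g @: setT| <= #|f @: setT|.
Proof.
(* Each value of [g] is sent to the value of [f] at a chosen preimage; the hypothesis on the kernels
   makes this injective. *)
move=> fg; pose h w := omap f [pick u | g u == w].
have pickg u : exists2 u', [pick u' | g u' == g u] = Some u' & g u' = g u.
  by case: pickP => [u' /eqP|/(_ u)]; [exists u' | rewrite eqxx].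
rewrite -(card_in_imset (f := h)) => [|_ _ /imsetP[u _ ->] /imsetP[v _ ->]].
  rewrite -[leqRHS](card_imset _ (@Some_inj _)).
  apply: subset_leq_card; apply/subsetP => x.
  case/imsetP=> _ /imsetP[u _ ->] ->; rewrite /h; have [u' -> _] := pickg u.
  by apply: imset_f; apply: imset_f; rewrite inE.
rewrite /h; have [u' -> <-] := pickg u; have [v' -> <-] := pickg v.
by move=> /= [] /fg.
Qed.

Lemma eq_card_imset_ker (U A B : finType) (f : U -> A) (g : U -> B) :
  (forall u v, (f u == f v) = (g u == g v)) -> #|f @: setT| = #|g @: setT|.
Proof.
move=> fg; apply/eqP; rewrite eqn_leq !leq_card_imset_ker // => u v /eqP.
  by rewrite fg => /eqP.
by rewrite -fg => /eqP.
Qed.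

Lemma partition_ker_inj (U : finType) (P Q : {set {set U}}) :
  partition P setT -> partition Q setT ->
  (forall u v, (pblock P u == pblock P v) = (pblock Q u == pblock Q v)) ->
  P = Q.
Proof.
move=> partP partQ eqPQ.
rewrite -(preim_partition_pblock partP) -(preim_partition_pblock partQ).
rewrite /preim_partition /equivalence_partition.
by apply: eq_imset => u; apply/setP=> v; rewrite !inE eqPQ.
Qed.

Lemma pblock_preim_partition (U : finType) (A : eqType) (f : U -> A) u v :
  (pblock (preim_partition f setT) u == pblock (preim_partition f setT) v)
  = (f u == f v).
Proof.
have partP := preim_partitionP f setT.
have tiP := partition_trivIset partP.
rewrite eq_pblock ?(cover_partition partP) ?inE //.
rewrite pblock_equivalence_partition ?inE // => x y z _ _ _.
by split=> // /eqP->.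
Qed.

Lemma imset_pblock (U : finType) (P : {set {set U}}) :
  partition P setT -> pblock P @: setT = P.
Proof.
move=> partP; apply/setP=> B; apply/imsetP/idP => [[u _ ->]|PB].
  by rewrite pblock_mem // (cover_partition partP).
have /set0Pn[u Bu] := partition_neq0 partP PB.
by exists u; rewrite ?inE // (def_pblock (partition_trivIset partP) PB).
Qed.

Lemma card_preim_partition (U A : finType) (f : U -> A) :
  #|preim_partition f setT| = #|f @: setT|.
Proof.
rewrite -(imset_pblock (preim_partitionP f setT)); apply: eq_card_imset_ker.
exact: pblock_preim_partition.
Qed.

Lemma set_ind1 (U : finType) (P : {set U} -> Prop) :
  P set0 -> (forall x (B : {set U}), x \notin B -> P B -> P (x |: B)) ->
  forall B : {set U}, P B.
Proof.
move=> P0 PS B; have [m] := ubnP #|B|; elim: m B => // m IHm B ltB.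
have [->//|[x xB]] := set_0Vmem B.
rewrite -(setD1K xB); apply: PS; first by rewrite !inE eqxx.
by apply: IHm; move: ltB; rewrite (cardsD1 x) xB.
Qed.

(** A new point can join any of the [b] blocks of a partition, and both the partition and the block
    can be read off from the result. *)
Lemma leq_mul_stirling2 N b : b * stirling2 N b <= stirling2 N.+1 b.
Proof.
pose S := [set P : {set {set 'I_N}} | partition P [set: 'I_N] & #|P| == b].
pose D := [set p : {set {set 'I_N}} * {set 'I_N} | (p.1 \in S) && (p.2 \in p.1)].
have cD : #|D| = b * stirling2 N b.
  rewrite -sum1_card (partition_big (fun p => p.1) (mem S)) /=; last first.
    by move=> p; rewrite inE => /andP[].
  rewrite mulnC /stirling2 -/S -sum_nat_const; apply: eq_bigr => P PS.
  have := PS; rewrite inE => /andP[_ /eqP <-].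
  rewrite sum1_card -(card_imset (mem P) (f := pair P)); last by move=> ? ? [].
  apply: eq_card => -[Q B]; apply/idP/imsetP => [|[C CP [-> ->]]].
    by case/andP => /[!inE]/= /andP[_ BQ] /eqP QP; exists B; rewrite -?QP.
  by rewrite unfold_in /= inE /= PS CP eqxx.
(* [g] labels an old point by its block and the new point [ord_max] by the chosen block; the
   enlarged partition is the kernel of [g]. *)
pose g (p : {set {set 'I_N}} * {set 'I_N}) (i : 'I_N.+1) :=
  if unlift ord_max i is Some j then pblock p.1 j else p.2.
have g_lift p j : g p (lift ord_max j) = pblock p.1 j by rewrite /g liftK.
have g_max p : g p ord_max = p.2 by rewrite /g unlift_none.
rewrite -cD /stirling2 -(card_in_imset (f := fun p => preim_partition (g p) setT)).
  apply: subset_leq_card; apply/subsetP => x /imsetP[[P B] + ->] {x}.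
  move=> /[!inE]/= /andP[/andP[pP /eqP cP] PB]; rewrite preim_partitionP.
  rewrite card_preim_partition /=.
  rewrite -cP -[in eqbRHS](imset_pblock pP); apply/eqP/eq_card => C.
  apply/imsetP/imsetP => [[i _ ->]|[j _ ->]]; last first.
    by exists (lift ord_max j); rewrite ?in_setT ?g_lift.
  case: (unliftP ord_max i) => [j ->|->]; first by exists j; rewrite ?g_lift.
  by rewrite g_max /=; apply/imsetP; rewrite imset_pblock.
move=> [P B] [Q C]; rewrite !inE /=.
move=> /andP[/andP[pP _] PB] /andP[/andP[pQ _] QC] PQ.
have ker i j : (g (P, B) i == g (P, B) j) = (g (Q, C) i == g (Q, C) j).
  by rewrite -!(pblock_preim_partition (g _)) PQ.
have eqPQ : P = Q.
  apply: partition_ker_inj => // i j.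
  by have := ker (lift ord_max i) (lift ord_max j); rewrite !g_lift.
subst Q; move: PB; rewrite -{1}(imset_pblock pP) => /imsetP[i _ Bi].
have := ker ord_max (lift ord_max i); rewrite !g_lift !g_max /= Bi eqxx.
by move/esym/eqP->.
Qed.

(** * Numerical estimates and a union bound *)

Lemma ffact_leq_expn m t : m ^_ t <= m ^ t.
Proof.
elim: t => // t IHt; rewrite ffactnSr expnSr; apply: leq_mul => //.
exact: leq_subr.
Qed.

Lemma bin_leq_expn m t : 'C(m, t) <= m ^ t.
Proof.
apply: leq_trans (ffact_leq_expn m t); rewrite -bin_ffact.
by rewrite leq_pmulr ?fact_gt0.
Qed.

(** Raising [k] by one multiplies the sum by [c] and adds 1; strictness leaves room for this 1
    because [c >= 2]. *)
Lemma geometric_sum_lt c q k : 1 < c -> q <= k ->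
  \sum_(q <= s < k.+1) c ^ (k - s) < 2 * c ^ (k - q).
Proof.
move=> c_gt1; elim: k => [|k IHk].
  by rewrite leqn0 => /eqP->; rewrite big_nat1 subnn.
rewrite leq_eqVlt => /predU1P[->|]; first by rewrite big_nat1 subnn.
rewrite ltnS => qk; rewrite big_nat_recr ?(leqW qk) //= subnn subSn // expnS.
rewrite (eq_big_nat _ _ (F2 := fun s => c * c ^ (k - s))); last first.
  by move=> s /andP[_ sk]; rewrite subSn // expnS.
rewrite -big_distrr /= expn0 addn1 mulnCA.
by apply: leq_trans (leq_mul (leqnn c) (IHk qk)); rewrite mulnS; lia.
Qed.

(** The factorial absorbs the factor 2. Since [t + j.+1 <= (t + 2) * 2 ^ j], each further factor on
    the right, being at least [2 ^ (2 * t)], pays for one doubling of the base. *)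
Lemma spread_constant t j : 0 < t ->
  2 * ((t + j.+1) ^ 2) ^ t <= ((t + 2) ^ (2 * t) * (2 * t)`!) ^ j.+1.
Proof.
move=> t_gt0; set D := (t + 2) ^ (2 * t).
have f2 : 2 <= (2 * t)`!.
  by apply: leq_trans (fact_geq _); rewrite leq_pmulr.
have leD : 2 ^ (2 * t) <= D by rewrite /D leq_exp2r ?leq_addl // muln_gt0.
have leq : t + j.+1 <= (t + 2) * 2 ^ j.
  have : j < 2 ^ j by apply: ltn_expl.
  by nia.
rewrite -expnM; apply: leq_trans (_ : 2 * (D * (2 ^ (2 * t)) ^ j) <= _).
  rewrite leq_mul2l /= /D -expnM (mulnC (2 * t) j) (expnM 2 j) -expnMn.
  by rewrite leq_exp2r // muln_gt0.
rewrite expnS mulnA [2 * D]mulnC; apply: leq_mul.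
  by rewrite leq_mul2l f2 orbT.
have [-> //|j_gt0] := posnP j; rewrite leq_exp2r //.
by apply: leq_trans leD _; rewrite leq_pmulr ?fact_gt0.
Qed.

Lemma leq_card_sum (U J : finType) (H : {set U}) (B : {set J})
    (R : J -> {set U}) :
  {in H, forall x, exists2 i, i \in B & x \in R i} ->
  #|H| <= \sum_(i in B) #|H :&: R i|.
Proof.
move=> HB; rewrite -sum1_card.
rewrite (eq_bigr (fun i => \sum_(x in H) (x \in R i : nat))); last first.
  move=> i _; rewrite -sum1_card big_mkcond [RHS]big_mkcond /=.
  by apply: eq_bigr => x _; rewrite in_setI; case: (x \in H); case: (x \in R i).
rewrite exchange_big /=; apply: leq_sum => x /HB[i iB xRi].
by rewrite (bigD1 i) //= xRi.
Qed.

(** * Connected components of edge sets *)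

Section Graphs.

Variable n : nat.
Implicit Types (X Y I F T : {set edge n}) (u v w : 'I_n.+1) (e : edge n).

Lemma edgeP e : exists u v, u != v /\ val e = [set u; v].
Proof. by have /cards2P[u [v [uv ->]]] := valP e; exists u, v. Qed.

Lemma mk_edge u v : u != v -> exists e, val e = [set u; v].
Proof.
move=> uv; have uvP : #|[set u; v]| == 2 by rewrite cards2 uv.
by exists (Sub [set u; v] uvP).
Qed.

Lemma adj_sym X : symmetric (adj X).
Proof. by move=> u v; rewrite /adj; apply: eq_existsb => e; rewrite setUC. Qed.

Lemma adjP X u v :
  reflect (exists2 e, e \in X & val e = [set u; v]) (adj X u v).
Proof.
by apply: (iffP exists_inP) => -[e eX /eqP euv]; exists e => //; apply/eqP.
Qed.

Lemma adj_csym X : connect_sym (adj X).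
Proof. exact/sym_connect_sym/adj_sym. Qed.

Lemma adj_subset X Y : X \subset Y -> subrel (adj X) (adj Y).
Proof. by move=> /subsetP XY u v /adjP[e /XY eY euv]; apply/adjP; exists e. Qed.

Lemma connect_subset X Y :
  X \subset Y -> subrel (connect (adj X)) (connect (adj Y)).
Proof.
by move=> /adj_subset XY; apply: connect_sub => u v /XY; apply: connect1.
Qed.

Lemma connect_inv X (A : Type) (h : 'I_n.+1 -> A) :
  (forall u v, adj X u v -> h u = h v) ->
  forall u v, connect (adj X) u v -> h u = h v.
Proof.
move=> hX u v /connectP[p Xp ->] {v}; elim: p u Xp => //= w p IHp u.
by case/andP=> /hX-> /IHp.
Qed.

Definition rt X := root (adj X).

Lemma rtE X u v : (rt X u == rt X v) = connect (adj X) u v.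
Proof. exact: root_connect (adj_csym X) u v. Qed.

(** The component labels after an edge joins [a] to [b]: the label of [b] gives way to that of
    [a]. *)
Definition merge (A : eqType) (f : 'I_n.+1 -> A) a b u :=
  if f u == f b then f a else f u.

Lemma connect_setU1 X e a b u v : val e = [set a; b] ->
  connect (adj (e |: X)) u v = (merge (rt X) a b u == merge (rt X) a b v).
Proof.
move=> eab; apply/idP/eqP => [|]; last first.
  have sub x y : rt X x == rt X y -> connect (adj (e |: X)) x y.
    by rewrite rtE; apply/connect_subset/subsetUr.
  have ab : connect (adj (e |: X)) a b.
    by apply/connect1/adjP; exists e; rewrite ?setU11.
  have csym := adj_csym (e |: X).
  rewrite /merge; case: ifP => [/sub ub|_]; case: ifP => [/sub vb|_] /eqP/sub uv.
  - by rewrite csym in vb; apply: connect_trans vb.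
  - by rewrite csym in ab; apply: connect_trans (connect_trans ub ab) uv.
  - by rewrite csym in vb; apply: connect_trans uv (connect_trans ab vb).
  exact: uv.
apply: connect_inv u v => u v /adjP[e'].
case/setU1P=> [-> | Xe' e'uv]; last first.
  rewrite /merge; suff /eqP-> : rt X u == rt X v by [].
  by rewrite rtE; apply/connect1/adjP; exists e'.
rewrite eab => uv; have : u \in [set a; b] by rewrite uv set21.
have : v \in [set a; b] by rewrite uv set22.
rewrite !inE /merge => /orP[]/eqP-> /orP[]/eqP->; rewrite ?eqxx //.
  by case: ifP.
by case: ifP.
Qed.

Definition nc X := #|rt X @: setT|.

Lemma nc_setU1 X e a b : val e = [set a; b] ->
  nc X = nc (e |: X) + ~~ connect (adj X) a b.
Proof.
move=> eab; rewrite /nc.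
rewrite (eq_card_imset_ker (f := rt (e |: X)) (g := merge (rt X) a b)); last first.
  by move=> u v; rewrite rtE; apply: connect_setU1.
rewrite -rtE; have [ab|ab] /= := eqVneq (rt X a) (rt X b).
  rewrite addn0; apply: eq_card_imset_ker => u v; rewrite /merge ab.
  by case: (rt X u =P rt X b) => [->|_]; case: (rt X v =P rt X b) => [->|_].
(* The merged labels are the old ones without the root of [b]. *)
rewrite (cardsD1 (rt X b)) imset_f ?inE // addnC; congr (_ + _).
apply: eq_card => x; rewrite in_setD1; apply/andP/imsetP.
  case=> xb /imsetP[u _ xu]; exists u; rewrite // /merge.
  by rewrite -xu (negbTE xb).
case=> u _ ->; rewrite /merge; case: (eqVneq (rt X u)) => [_|ub].
  by rewrite ab imset_f.
by rewrite ub imset_f.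
Qed.

Lemma nc_mem X e a b : e \in X -> val e = [set a; b] ->
  nc (X :\ e) = nc X + ~~ connect (adj (X :\ e)) a b.
Proof. by move=> eX eab; rewrite (nc_setU1 _ eab) setD1K. Qed.

Lemma nc0 : nc set0 = n.+1.
Proof.
rewrite /nc card_imset ?cardsT ?card_ord // => u v /eqP; rewrite rtE.
by apply: connect_inv => {}u {}v /adjP[e]; rewrite inE.
Qed.

Lemma nc_subset X Y : X \subset Y -> nc Y <= nc X.
Proof.
move=> XY; apply: leq_card_imset_ker => u v /eqP uv; apply/eqP.
by move: uv; rewrite !rtE; apply: connect_subset.
Qed.

Lemma card_nc_ge X : n < #|X| + nc X.
Proof.
elim/set_ind1: X => [|e X eX IHX]; first by rewrite nc0 cards0.
have [a [b [_ eab]]] := edgeP e; rewrite cardsU1 eX.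
move: IHX; rewrite (nc_setU1 X eab); case: connect.
  by rewrite /= add1n addSn addn0; apply: leqW.
by rewrite /= add1n addSn addn1 addnS.
Qed.

(** * Forests and the rank formula *)

Lemma forestPn I :
  reflect (exists c, [/\ 2 < size c, cycle (adj I) c & uniq c]) (~~ forest I).
Proof.
apply: (iffP idP) => [|[c [c2 Ic Uc]]].
  case/forallPn=> m /forallPn[c]; rewrite negb_imply negbK => /andP[m2].
  by case/andP=> Ic Uc; exists c; rewrite size_tuple.
have ltc : size c < n.+2.
  by rewrite ltnS -(card_uniqP Uc) -[leqRHS]card_ord max_card.
apply/forallPn; exists (Ordinal ltc); apply/forallPn; exists (in_tuple c).
by rewrite negb_imply c2 negbK /ucycleb Ic.
Qed.

Lemma forest_subset I X : I \subset X -> forest X -> forest I.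
Proof.
move=> IX; apply: contraLR => /forestPn[c [c2 Ic Uc]]; apply/forestPn.
by exists c; split=> //; apply: sub_cycle Ic; apply: adj_subset.
Qed.

Lemma edge_inj e e' : val e = val e' -> e = e'.
Proof. exact: val_inj. Qed.

(** A simple path from [a] to [b] in [X] would be closed by [e] to a cycle; it has a third vertex
    because [e] is not in [X]. *)
Lemma forest_bridge X e a b : e \notin X -> val e = [set a; b] ->
  forest (e |: X) -> ~~ connect (adj X) a b.
Proof.
move=> eX eab; apply: contraL => /connectP[p0 Xp0 bE]; apply/forestPn.
have ab : a != b.
  by move: (valP e); rewrite eab cards2; case: (a == b).
move: bE; case/shortenP: Xp0 => p Xp Up _ bE; exists (a :: p); split=> //.
  case: p Xp bE {Up} => [_ bE|x [|? ?]] //=; first by rewrite bE eqxx in ab.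
  rewrite andbT => /adjP[e' Xe' e'ax] bE; case/negP: eX.
  by rewrite (_ : e = e') //; apply: edge_inj; rewrite eab e'ax bE.
rewrite /= rcons_path -bE (sub_path (adj_subset (subsetUr _ _)) Xp).
by apply/adjP; exists e; rewrite ?setU11 // setUC.
Qed.

(** For the edge between the first two vertices, the rest of the cycle is a detour: each of its
    steps has an endpoint outside these two. *)
Lemma cycle_nonbridge X c : 2 < size c -> cycle (adj X) c -> uniq c ->
  exists e a b,
    [/\ e \in X, val e = [set a; b] & connect (adj (X :\ e)) a b].
Proof.
case: c => [|x [|y [|z p]]] //= _ /and3P[/adjP[e eX exy] yz zp] Uc.
exists e, x, y; split=> //; rewrite adj_csym.
have stepD u v : u \notin [set x; y] -> adj X u v -> adj (X :\ e) u v.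
  move=> uxy /adjP[f fX fuv]; apply/adjP; exists f => //.
  rewrite !inE fX andbT; apply: contraNneq uxy => fe.
  by rewrite -exy -fe fuv set21.
move: Uc; rewrite !inE !negb_or -!andbA.
case/and5P=> xy xz xp y_z /and3P[yp zNp _].
have zxy : z \notin [set x; y] by rewrite !inE negb_or ![z == _]eq_sym xz.
have/connect1 : adj (X :\ e) y z by rewrite adj_sym stepD // adj_sym.
move/connect_trans; apply.
elim: p z zxy zp xp yp {xz y_z zNp yz} => [|w p IHp] z zxy /=.
  by rewrite andbT => zx _ _; apply/connect1/stepD.
case/andP=> zw wp; rewrite !inE !negb_or => /andP[xw xp] /andP[yw yp].
apply: connect_trans (connect1 (stepD _ _ zxy zw)) _; apply: IHp => //.
by rewrite !inE negb_or ![w == _]eq_sym xw.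
Qed.

(** Building up a forest, each new edge joins two components. Conversely, removing an edge of a
    cycle keeps the components, and the smaller set would violate [card_nc_ge]. *)
Lemma forestE I : forest I = (#|I| + nc I == n.+1).
Proof.
apply/idP/eqP => [|eqI].
  elim/set_ind1: I => [|e X eX IHX] fX; first by rewrite nc0 cards0.
  have [a [b [_ eab]]] := edgeP e.
  rewrite -[RHS]IHX; last by apply: forest_subset fX; apply: subsetUr.
  rewrite cardsU1 eX (nc_setU1 X eab) (forest_bridge eX eab fX) add1n.
  by rewrite addn1 addSn addnS.
apply/negPn/forestPn => -[c [c2 Ic Uc]].
have [e [a [b [eI eab ab]]]] := cycle_nonbridge c2 Ic Uc.
have := card_nc_ge (I :\ e); rewrite (nc_mem eI eab) ab addn0.
by have := cardsD1 e I; rewrite eI add1n -ltnS -addSn => <-; rewrite eqI ltnn.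
Qed.

(** Greedy spanning forest: an edge is kept only if it joins two components. *)
Lemma exists_forest X :
  exists I, [/\ I \subset X, forest I & nc I = nc X].
Proof.
elim/set_ind1: X => [|e X eX [I [IX fI ncI]]].
  by exists set0; split=> //; rewrite forestE cards0 nc0.
have [a [b [_ eab]]] := edgeP e.
have := nc_setU1 X eab; have [ab|ab] /= := boolP (connect (adj X) a b).
  rewrite addn0 => ncX; exists I.
  split; [|exact: fI | exact: etrans ncI ncX].
  exact: subset_trans IX (subsetUr _ _).
rewrite addn1 => ncX; exists (e |: I).
have eI : e \notin I by apply: contra eX; apply/subsetP.
have abI : ~~ connect (adj I) a b by apply: contra ab; apply: connect_subset.
have ncE : nc (e |: I) = nc (e |: X).
  by apply: succn_inj; rewrite -ncX -ncI (nc_setU1 I eab) abI addn1.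
split; [exact: setUS IX | | exact: ncE].
rewrite forestE cardsU1 eI ncE add1n addSnnS -ncX -ncI -forestE; exact: fI.
Qed.

(** A spanning forest attains the maximum, since any forest inside [X] has at least as many
    components as [X] and so no more edges. *)
Lemma rkE X : rk X + nc X = n.+1.
Proof.
have [I [IX fI ncI]] := exists_forest X.
suff -> : rk X = #|I| by rewrite -ncI; apply/eqP; rewrite -forestE.
apply/eqP; rewrite eqn_leq /rk /mrank; apply/andP; split; last first.
  by apply: (leq_bigmax_cond (F := fun I : {set _} => #|I|)); rewrite IX.
apply/bigmax_leqP => J /andP[JX]; rewrite forestE => /eqP cJ.
move: fI; rewrite forestE => /eqP cI.
by rewrite -(leq_add2r (nc I)) cI -[leqRHS]cJ leq_add2l ncI nc_subset.
Qed.

Lemma ncE X : nc X = n.+1 - rk X.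
Proof. exact: etrans (esym (addKn _ _)) (congr1 (subn^~ (rk X)) (rkE X)). Qed.

Lemma rk_forest I : forest I -> rk I = #|I|.
Proof.
by rewrite forestE => /eqP fI; apply/eqP; rewrite -(eqn_add2r (nc I)) rkE fI.
Qed.

Lemma rk_subset X Y : X \subset Y -> rk X <= rk Y.
Proof.
move=> /nc_subset leX; rewrite -(leq_add2r (nc Y)) rkE.
by rewrite -[leqRHS](rkE X) leq_add2l.
Qed.

Lemma rk_setU1 X e a b : val e = [set a; b] ->
  rk (e |: X) = rk X + ~~ connect (adj X) a b.
Proof.
move=> eab; apply: (@addIn (nc (e |: X))); rewrite rkE.
by apply: etrans (esym (rkE X)) _; rewrite (nc_setU1 X eab) addnA addnAC.
Qed.

Lemma exists_indep_subset X t : t <= rk X ->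
  exists I, [/\ I \subset X, #|I| = t & rk I = t].
Proof.
have [J [JX fJ ncJ]] := exists_forest X.
rewrite (_ : rk X = #|J|); last first.
  by rewrite -(rk_forest fJ); apply/eqP; rewrite -(eqn_add2r (nc X)) rkE -ncJ rkE.
move=> tJ; have : 0 < #|[set I : {set edge n} | I \subset J & #|I| == t]|.
  by rewrite cards_draws bin_gt0.
case/card_gt0P=> I; rewrite inE => /andP[IJ /eqP cI].
have fI := forest_subset IJ fJ; exists I.
split; [exact: subset_trans JX | exact: cI | by rewrite (rk_forest fI) cI].
Qed.

(** * Kernels of vertex maps, closure and flats *)

Definition kerE (A : eqType) (h : 'I_n.+1 -> A) : {set edge n} :=
  [set e : edge n | [forall u in val e, forall v in val e, h u == h v]].

Lemma mem_kerE (A : eqType) (h : 'I_n.+1 -> A) e a b :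
  val e = [set a; b] -> (e \in kerE h) = (h a == h b).
Proof.
move=> eab; rewrite inE; apply/forall_inP/eqP => [hE|hab u].
  have /hE/forall_inP/(_ b) : a \in val e by rewrite eab set21.
  by rewrite eab set22 => /(_ isT)/eqP.
rewrite eab => uab; apply/forall_inP => v; move: uab; rewrite !inE.
by case/orP=> /eqP-> /orP[]/eqP->; rewrite ?hab.
Qed.

Lemma connect_kerE (A : eqType) (h : 'I_n.+1 -> A) u v :
  connect (adj (kerE h)) u v = (h u == h v).
Proof.
apply/idP/eqP => [|huv].
  apply: connect_inv u v => u v /adjP[e he euv].
  by move: he; rewrite (mem_kerE h euv) => /eqP.
have [-> //|/mk_edge[e euv]] := eqVneq u v.
by apply/connect1/adjP; exists e; rewrite // (mem_kerE h euv) huv.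
Qed.

Lemma nc_kerE (A : finType) (h : 'I_n.+1 -> A) : nc (kerE h) = #|h @: setT|.
Proof. by apply: eq_card_imset_ker => u v; rewrite rtE connect_kerE. Qed.

(** The matroid closure, written as a kernel. *)
Definition cl X := kerE (rt X).

Lemma mem_cl X e a b :
  val e = [set a; b] -> (e \in cl X) = connect (adj X) a b.
Proof. by move/mem_kerE->; rewrite rtE. Qed.

Lemma sub_cl X : X \subset cl X.
Proof.
apply/subsetP=> e eX; have [a [b [_ eab]]] := edgeP e.
by rewrite (mem_cl X eab); apply/connect1/adjP; exists e.
Qed.

Lemma flatE F : is_flat (@forest n) F = (cl F \subset F).
Proof.
apply/forallP/subsetP => [fF e|fF e].
  have [a [b [_ eab]]] := edgeP e; rewrite (mem_cl F eab) => ab.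
  have /implyP := fF e; rewrite -/(rk F) -/(rk (e |: F)).
  rewrite (rk_setU1 F eab) ab addn0 ltnn.
  by case: (e \in F) => // /(_ isT).
apply/implyP=> eF; have [a [b [_ eab]]] := edgeP e.
rewrite -/(rk F) -/(rk (e |: F)) (rk_setU1 F eab) -(mem_cl F eab).
by rewrite (contra (fF e) eF) addn1.
Qed.

Lemma flat_kerE (A : eqType) (h : 'I_n.+1 -> A) : is_flat (@forest n) (kerE h).
Proof.
rewrite flatE; apply/subsetP=> e; have [a [b [_ eab]]] := edgeP e.
by rewrite (mem_cl _ eab) (mem_kerE h eab) connect_kerE.
Qed.

Lemma flat_cl X : is_flat (@forest n) (cl X).
Proof. exact: flat_kerE. Qed.

Lemma rk_cl X : rk (cl X) = rk X.
Proof. by apply: (@addIn (nc X)); rewrite rkE -[RHS](rkE (cl X)) nc_kerE. Qed.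

Lemma cl_subset X F : is_flat (@forest n) F -> X \subset F -> cl X \subset F.
Proof.
rewrite flatE => /subsetP fF XF; apply/subsetP=> e.
have [a [b [_ eab]]] := edgeP e; rewrite (mem_cl X eab) => ab.
by apply: fF; rewrite (mem_cl F eab); apply: connect_subset ab.
Qed.

Lemma rk_flat_setU1 F e :
  is_flat (@forest n) F -> e \notin F -> rk (e |: F) = (rk F).+1.
Proof.
rewrite flatE => /subsetP fF eF; have [a [b [_ eab]]] := edgeP e.
by rewrite (rk_setU1 F eab) -(mem_cl F eab) (contra (fF e) eF) addn1.
Qed.

Lemma flat_subset_eq F X :
  is_flat (@forest n) F -> F \subset X -> rk X <= rk F -> F = X.
Proof.
move=> fF FX rX; apply/eqP; rewrite eqEsubset FX; apply/subsetP=> e eX.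
apply: contraTT rX => eF; rewrite -ltnNge -(rk_flat_setU1 fF eF).
by apply: rk_subset; rewrite subUset sub1set eX.
Qed.

(* Each edge has an endpoint u other than the chosen root of its component; its
   other endpoint v is another such vertex, or the root, encoded by u itself. *)
Lemma card_leq_rk X : #|X| <= rk X ^ 2.
Proof.
pose N := ~: (rt X @: setT).
have cN : #|N| = rk X.
  by apply: (@addIn (nc X)); rewrite rkE addnC cardsC card_ord.
have rtN u : (u \notin N) = (rt X u == u).
  rewrite inE negbK; apply/imsetP/eqP => [[v _ ->]|ru]; last by exists u.
  exact: root_root (adj_csym X) v.
pose D := [set p : 'I_n.+1 * 'I_n.+1 |
  [&& p.1 \in N, p.2 != p.1 & connect (adj X) p.1 p.2]].
pose g (p : 'I_n.+1 * 'I_n.+1) := (p.1, if p.2 \in N then p.2 else p.1).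
have leD : #|D| <= rk X ^ 2.
  rewrite -(card_in_imset (f := g)).
    rewrite -mulnn -cN -cardsX; apply: subset_leq_card; apply/subsetP => x.
    case/imsetP=> -[u v]; rewrite inE => /and3P[/= uN _ _] ->.
    by rewrite inE /= uN; case: ifP.
  move=> [u v] [u' v']; rewrite !inE -!rtE => /and3P[/= _ vu uv].
  case/and3P=> /= _ vu' uv'; rewrite /g /= => -[uu']; subst u'.
  case: ifPn => vN; case: ifPn => vN'.
  - by move=> ->.
  - by move=> vE; rewrite vE eqxx in vu.
  - by move=> vE; rewrite -vE eqxx in vu'.
  move: vN vN'; rewrite !rtN => /eqP vE /eqP vE' _.
  by rewrite -vE -vE' -(eqP uv) -(eqP uv').
apply: leq_trans leD; rewrite -(card_imset X val_inj).
apply: leq_trans (leq_imset_card (fun p => [set p.1; p.2]) _).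
apply: subset_leq_card; apply/subsetP=> _ /imsetP[e eX ->].
have [a [b [ab eab]]] := edgeP e.
have adj_ab : connect (adj X) a b by apply/connect1/adjP; exists e.
have [aN|] := boolP (a \in N).
  by apply/imsetP; exists (a, b); rewrite // inE /= aN eq_sym ab.
rewrite rtN => /eqP ra; apply/imsetP; exists (b, a); last by rewrite /= setUC.
rewrite inE /= ab adj_csym adj_ab !andbT; apply: contraNT ab.
by rewrite rtN => /eqP <-; rewrite -ra rtE.
Qed.

(** * Counting the flats above a given flat *)

Lemma rk_flats F k : F \in flats n k -> rk F = k.
Proof. by rewrite inE => /andP[_ /eqP]. Qed.

Lemma flats_flat F k : F \in flats n k -> is_flat (@forest n) F.
Proof. by rewrite inE => /andP[]. Qed.

(** A flat above [T] is the kernel of a vertex map constant on the components of [T], so it amounts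
    to a partition of these components. *)
Lemma card_flats_above T k : is_flat (@forest n) T -> k <= n ->
  #|[set F in flats n k | T \subset F]| = stirling2 (nc T) (n.+1 - k).
Proof.
move=> fT lekn; pose R := rt T @: setT.
have RT u : rt T u \in R by rewrite imset_f.
(* [phi] numbers the component of a vertex; [psi] returns the root of a numbered component. *)
pose phi u : 'I_(nc T) := enum_rank_in (RT ord0) (rt T u).
pose psi (i : 'I_(nc T)) : 'I_n.+1 := @enum_val _ (mem R) i.
have rt_psi i : rt T (psi i) = psi i.
  have /imsetP[u _ ->] : psi i \in R := enum_valP i.
  exact: root_root (adj_csym T) u.
have phiK i : phi (psi i) = i by rewrite /phi rt_psi; apply: enum_valK_in.
have psiK u : psi (phi u) = rt T u by apply: enum_rankK_in.
pose Phi (Q : {set {set 'I_(nc T)}}) := kerE (fun u => pblock Q (phi u)).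
rewrite /stirling2 -(card_in_imset (f := Phi)); last first.
  move=> P Q; rewrite !inE => /andP[pP _] /andP[pQ _] PQ.
  apply: partition_ker_inj => // i j; rewrite -(phiK i) -(phiK j).
  have := connect_kerE (fun u => pblock P (phi u)) (psi i) (psi j).
  by rewrite -/(Phi P) PQ connect_kerE.
apply: eq_card => F; apply/idP/imsetP => [|[Q QS ->]].
  rewrite inE => /andP[]; rewrite inE => /andP[fF /eqP rF] TF.
  have rtu u : rt F (rt T u) = rt F u.
    apply/eqP; rewrite rtE adj_csym; apply: (connect_subset TF).
    exact: connect_root.
  (* The partition attached to [F] groups the components of [T] that lie in the same component of
     [F]. *)
  exists (preim_partition (rt F \o psi) setT).
    rewrite inE preim_partitionP card_preim_partition /=.
    rewrite -rF -ncE; apply/eqP/eq_card => x; apply/imsetP/imsetP.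
      by case=> i _ ->; exists (psi i).
    by case=> u _ ->; exists (phi u); rewrite ?inE // -rtu -psiK.
  apply/setP=> e; have [a [b [_ eab]]] := edgeP e.
  rewrite (mem_kerE _ eab) pblock_preim_partition /= !psiK !rtu rtE -(mem_cl F eab).
  suff -> : cl F = F by [].
  by apply/eqP; rewrite eqEsubset sub_cl -flatE fF.
move: QS => /[!inE]/andP[pQ /eqP cQ]; rewrite ?inE flat_kerE /=.
apply/andP; split; last first.
  apply/subsetP=> e eT; have [a [b [_ eab]]] := edgeP e.
  rewrite (mem_kerE _ eab) /phi.
  suff /eqP-> : rt T a == rt T b by [].
  by rewrite rtE; apply/connect1/adjP; exists e.
have ncQ : nc (Phi Q) = n.+1 - k.
  rewrite nc_kerE -cQ -[in RHS](imset_pblock pQ); apply: eq_card => B.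
  apply/imsetP/imsetP => [[u _ ->]|[i _ ->]]; first by exists (phi u).
  by exists (psi i); rewrite ?phiK.
by rewrite -(eqn_add2r (nc (Phi Q))) rkE ncQ subnKC // leqW.
Qed.

End Graphs.

(** * Spread covers of intersecting families *)

Section Families.

Variable n : nat.
Implicit Types (S T F B : {set edge n}) (G : {set {set edge n}}) (e : edge n).

(** A boolean condition, so that families can be minimised under it. *)
Definition tint t G := [forall F in G, forall H in G, t <= rk (F :&: H)].

Lemma tintP t G :
  reflect {in G &, forall F H : {set edge n}, t <= rk (F :&: H)} (tint t G).
Proof.
apply: (iffP forall_inP) => [tG F H FG HG|tG F FG].
  by have /forall_inP := tG F FG; apply.
by apply/forall_inP => H HG; apply: tG.
Qed.

(* S maximises r ^ rk S * #|{F in H | S \subset F}|: by maximality, for every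
   B in G fewer than #|B| / r < 1 of those F meet B outside S, so some F
   satisfies F :&: B \subset S. *)
Lemma spread_flat G k t s r T :
  {in G, forall F, is_flat (@forest n) F && (rk F <= k)} -> tint t G ->
  k ^ 2 < r -> is_flat (@forest n) T ->
  r ^ (s - rk T) < #|[set F in G | (rk F == s) && (T \subset F)]| ->
  exists S F, [/\ is_flat (@forest n) S, rk S < s, F \in G,
    rk F = s /\ S \subset F & {in G, forall B, t <= rk (S :&: B)}].
Proof.
move=> GP /tintP tG kr fT; set H := [set F in G | _] => ltH.
have r_gt0 : 0 < r by apply: leq_ltn_trans kr.
pose h S := #|[set F in H | S \subset F]|.
have hT : h T = #|H|.
  by apply: eq_card => F; rewrite !inE -!andbA andbb.
have HP F : F \in H ->
    [/\ F \in G, rk F = s, is_flat (@forest n) F & T \subset F].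
  rewrite inE => /and3P[FG /eqP rF TF]; split=> //.
  by have /andP[] := GP F FG.
clearbody H.
pose P S := [&& is_flat (@forest n) S, T \subset S & 0 < h S].
have PT : P T by rewrite /P fT subxx hT; apply: leq_ltn_trans ltH.
case: (arg_maxnP (fun S => r ^ rk S * h S) PT) => S /and3P[fS TS hS_gt0] maxS.
have /card_gt0P[F0] := hS_gt0; rewrite inE => /andP[/HP[F0G rF0 _ TF0] SF0].
have rTs : rk T <= s by rewrite -rF0 rk_subset.
(* Otherwise [S] is itself the only member of [H] above [S], so [h S = 1], and comparing [S] with
   [T] bounds the size of [H] by [r ^ (s - rk T)]. *)
have rSs : rk S < s.
  rewrite -rF0 ltnNge; apply: contraTN ltH => rS; rewrite -leqNgt.
  have := maxS T PT; rewrite hT (_ : h S = 1); last first.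
    apply/eqP; rewrite eqn_leq hS_gt0 andbT -(cards1 S).
    apply: subset_leq_card; apply/subsetP => F; rewrite !inE => /andP[FH SF].
    have [_ rF _ _] := HP F FH.
    by rewrite eq_sym; apply/eqP/flat_subset_eq; rewrite // rF -rF0.
  have -> : rk S = s by apply/eqP; rewrite eqn_leq -{1}rF0 rk_subset // -rF0.
  rewrite /= muln1 => maxT.
  have r_pos : 0 < r ^ rk T by rewrite expn_gt0 r_gt0.
  by rewrite -(leq_pmul2l r_pos) -expnD subnKC.
exists S, F0; split=> // B BG.
have [F /andP[]|noF] :=
    pickP [pred F | (F \in H) && (S \subset F) & F :&: B \subset S].
  case/andP=> /HP[FG _ _ _] SF FBS; apply: leq_trans (tG _ _ FG BG) _.
  by apply: rk_subset; rewrite subsetI FBS subsetIr.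
(* If the closure lies below some member of [H], it competes with [S] in the maximisation at rank
   one higher. *)
have le_h e : e \in B :\: S -> r * h (cl (e |: S)) <= h S.
  rewrite inE => /andP[eS _]; have [-> |h_gt0] := posnP (h (cl (e |: S))).
    by rewrite muln0.
  have S1 := sub_cl (e |: S).
  have /maxS : P (cl (e |: S)).
    rewrite /P flat_cl h_gt0 andbT /=.
    exact: subset_trans TS (subset_trans (subsetUr _ _) S1).
  by rewrite /= rk_cl rk_flat_setU1 // expnSr -mulnA leq_pmul2l // expn_gt0 r_gt0.
have leB : #|B :\: S| <= k ^ 2.
  apply: leq_trans (subset_leq_card (subsetDl B S)) _.
  apply: leq_trans (card_leq_rk B) _; rewrite leq_exp2r //.
  by have /andP[] := GP B BG.
suff : r * h S <= k ^ 2 * h S.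
  by rewrite leq_mul2r eqn0Ngt hS_gt0 leqNgt kr.
(* Every member of [H] above [S] now meets [B] in an edge [e] outside [S], hence contains the
   closure of [e |: S]. *)
have hU : h S <= \sum_(e in B :\: S) h (cl (e |: S)).
  apply: leq_trans (_ : _ <= \sum_(e in B :\: S)
    #|[set F in H | S \subset F] :&: [set F in H | cl (e |: S) \subset F]|) _.
    apply: leq_card_sum => F; rewrite inE => /andP[FH SF].
    have /subsetPn[e] : ~~ (F :&: B \subset S).
      by have := noF F; rewrite /= FH SF /= => ->.
    rewrite inE => /andP[eF eB] eS; exists e; rewrite !inE ?eS ?eB //.
    rewrite FH cl_subset // ?subUset ?sub1set ?eF //.
    by have [] := HP F FH.
  by apply: leq_sum => e _; apply/subset_leq_card/subsetIr.
apply: leq_trans (_ : _ <= \sum_(e in B :\: S) h S) _.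
  apply: leq_trans (_ : _ <= r * \sum_(e in B :\: S) h (cl (e |: S))) _.
    by rewrite leq_mul2l hU orbT.
  by rewrite big_distrr /=; apply: leq_sum => e /le_h.
by rewrite sum_nat_const leq_mul2r leB orbT.
Qed.

(** [A] covers itself, so a cover with least sum of ranks exists. If it were not spread, the flat
    from [spread_flat] could replace all members above it and lower the sum. *)
Lemma exists_spread_cover (A : {set {set edge n}}) k t r :
  {in A, forall F, is_flat (@forest n) F && (rk F <= k)} -> tint t A ->
  k ^ 2 < r ->
  exists G, [/\ {in G, forall F, is_flat (@forest n) F && (rk F <= k)}, tint t G,
    {in A, forall F, exists2 H, H \in G & H \subset F}
    & forall T s, is_flat (@forest n) T ->
        #|[set F in G | (rk F == s) && (T \subset F)]| <= r ^ (s - rk T)].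
Proof.
move=> AP tA kr.
pose P (G : {set {set edge n}}) := [&& tint t G,
  [forall F in G, is_flat (@forest n) F && (rk F <= k)]
  & [forall F in A, exists H in G, H \subset F]].
have PA : P A.
  rewrite /P tA /=; apply/andP; split; apply/forall_inP => F FA; first exact: AP.
  by apply/exists_inP; exists F.
case: (arg_minnP (fun G : {set {set edge n}} => \sum_(F in G) rk F) PA) => G.
case/and3P=> tG /forall_inP GP /forall_inP AG minG; exists G; split=> //.
  by move=> F /AG /exists_inP.
move=> T s fT; rewrite leqNgt; apply/negP => ltG.
have [S [F0 [fS rS F0G [rF0 SF0] tS]]] := spread_flat GP tG kr fT ltG.
pose N := [set F in G | ~~ (S \subset F)].
have SN : S \notin N by rewrite inE subxx andbF.
have NG : {subset N <= G} by move=> F; rewrite inE => /andP[].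
have : P (S |: N).
  apply/and3P; split.
  - have tSS : t <= rk S.
      by apply: leq_trans (tS _ F0G) _; apply/rk_subset/subsetIl.
    apply/tintP => F H /setU1P[->|/NG FG] /setU1P[->|/NG HG].
    + by rewrite setIid.
    + exact: tS.
    + by rewrite setIC; apply: tS.
    + by move/tintP: tG; apply.
  - apply/forall_inP => F /setU1P[->|/NG/GP//]; rewrite fS /=.
    by have /andP[_] := GP _ F0G; rewrite rF0; apply/leq_trans/ltnW.
  apply/forall_inP => F /AG/exists_inP[H HG HF]; apply/exists_inP.
  have [SH|SH] := boolP (S \subset H).
    by exists S; rewrite ?setU11 // (subset_trans SH).
  by exists H => //; rewrite !inE HG SH orbT.
have sumN : \sum_(F in N) rk F = \sum_(F in G | ~~ (S \subset F)) rk F.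
  by apply: eq_bigl => F; rewrite inE.
(* The members above [S] contribute at least [rk F0 = s], which exceeds the rank of their
   replacement [S]. *)
move/minG; rewrite big_setU1 //= (bigID (fun F : {set edge n} => S \subset F)) /=.
rewrite sumN leq_add2r (bigD1 F0) ?F0G //= rF0 leqNgt; case/negP.
exact: leq_trans rS (leq_addr _ _).
Qed.

End Families.

(** * The bound for families without a common rank-[t] flat *)

Lemma leq_expn_mul_stirling2 b N d :
  b ^ d * stirling2 N b <= stirling2 (N + d) b.
Proof.
elim: d => [|d IHd]; first by rewrite mul1n addn0.
rewrite addnS expnS -mulnA; apply: leq_trans (leq_mul_stirling2 _ _).
by rewrite leq_mul2l IHd orbT.
Qed.

Section Bound.

Variables n k t : nat.
Hypotheses (t_gt0 : 0 < t) (lekn : k <= n).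

Let b := n.+1 - k.
Let r := (k ^ 2).+1.
(** Half of [c_ t]; the remaining factor 2 is spent on [r]. *)
Let c := (t + 2) ^ (2 * t) * (2 * t)`!.

Hypothesis leq_b : c * r <= b.

(** The cases are whether the spread cover has a member of rank [t]. Strictness in the second case
    settles when equality holds. *)
Lemma nontrivial_bound (A : {set {set edge n}}) :
  A \subset flats n k -> A != set0 -> tint t A ->
  (exists2 T, T \in flats n t & {in A, forall F : {set edge n}, T \subset F}) \/
  #|A| < stirling2 (n.+1 - t) b.
Proof.
move=> /subsetP Ak A0 tA.
have AP : {in A, forall F, is_flat (@forest n) F && (rk F <= k)}.
  by move=> F /Ak; rewrite inE => /andP[-> /eqP->] /=.
have [G [GP tG AG spreadG]] := exists_spread_cover AP tA (ltnSn _ : k ^ 2 < r).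
have [F1 F1A] := set0Pn _ A0; have [H1 H1G _] := AG _ F1A.
case: (arg_minnP (fun F : {set edge n} => rk F) H1G) => G0 G0G minG.
set q := rk G0 in minG.
have /andP[fG0 qk] := GP _ G0G.
have tq : t <= q by have /tintP/(_ _ _ G0G G0G) := tG; rewrite setIid.
move: tq; rewrite leq_eqVlt => /predU1P[qt|tq]; [left | right].
  exists G0 => [|F FA]; first by rewrite inE fG0 /= -/q qt.
  have [H HG HF] := AG F FA; apply: subset_trans HF.
  have /andP[fH _] := GP _ HG; move/tintP: tG => /(_ _ _ G0G HG) tGH.
  (* The intersection already has rank at least [t = rk G0], so it spans [G0]. *)
  have <- : cl (G0 :&: H) = G0; last exact: cl_subset fH (subsetIr _ _).
  apply: flat_subset_eq; [exact: flat_cl | exact: cl_subset fG0 (subsetIl _ _) |].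
  by rewrite rk_cl -/q -qt.
pose W s := stirling2 (n.+1 - s) b.
have cA : #|A| <= \sum_(H in G) W (rk H).
  pose R (H : {set edge n}) := [set F in flats n k | H \subset F].
  apply: leq_trans (_ : _ <= \sum_(H in G) #|A :&: R H|) _.
    apply: leq_card_sum => F FA; have [H HG HF] := AG F FA.
    by exists H; rewrite // inE Ak.
  apply: leq_sum => H /GP/andP[fH _]; rewrite /W -ncE -card_flats_above //.
  exact/subset_leq_card/subsetIr.
pose g s := [set F in G | rk F == s].
(* Each member meets [G0] in rank at least [t], so it contains an independent [t]-subset [I] of
   [G0]; spreadness bounds the members above [cl I]. *)
have cg s : #|g s| <= (q ^ 2) ^ t * r ^ (s - t).
  pose D := [set I : {set edge n} | (I \subset G0) && (#|I| == t) & rk I == t].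
  pose R (I : {set edge n}) := [set F : {set edge n} | I \subset F].
  apply: leq_trans (_ : _ <= \sum_(I in D) #|g s :&: R I|) _.
    apply: leq_card_sum => F; rewrite inE => /andP[FG _].
    have /tintP/(_ _ _ FG G0G)/exists_indep_subset[I [IFG /eqP cI /eqP rI]] := tG.
    move: IFG; rewrite subsetI => /andP[IF IG].
    by exists I; rewrite inE // IG cI rI.
  apply: leq_trans (_ : _ <= \sum_(I in D) r ^ (s - t)) _.
    apply: leq_sum => I; rewrite inE => /andP[_ /eqP rI].
    have := spreadG (cl I) s (flat_cl I); rewrite rk_cl rI; apply: leq_trans.
    apply: subset_leq_card; apply/subsetP => F; rewrite !inE.
    case/andP=> /andP[FG ->] IF; rewrite FG /= cl_subset //.
    by have /andP[] := GP _ FG.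
  rewrite sum_nat_const leq_mul2r; apply/orP; right.
  apply: leq_trans (_ : 'C(#|G0|, t) <= _).
    rewrite -cards_draws; apply: subset_leq_card; apply/subsetP => I.
    by rewrite !inE => /andP[].
  apply: leq_trans (bin_leq_expn _ _) _.
  by rewrite leq_exp2r // card_leq_rk.
(* Each unit of rank gains a factor [b >= c * r]: [r] pays for the growth of [g s], and [c] is left
   for the geometric sum. *)
have cW s : t <= s -> s <= k -> c ^ (s - t) * (r ^ (s - t) * W s) <= W t.
  move=> ts sk; rewrite mulnA -expnMn.
  apply: leq_trans (_ : b ^ (s - t) * W s <= _).
    rewrite leq_mul2r; apply/orP; right.
    by case: (s - t) => // d; rewrite leq_exp2r.
  apply: leq_trans (leq_expn_mul_stirling2 _ _ _) _.
  by rewrite addnBA // subnK // (leq_trans sk) // leqW.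
have c_gt1 : 1 < c.
  apply: (@leq_trans ((t + 2) ^ (2 * t))); last by rewrite leq_pmulr ?fact_gt0.
  apply: (@leq_trans (t + 2)); first by rewrite addn2.
  by rewrite -{1}(expn1 (t + 2)) leq_exp2l ?muln_gt0 // addn2.
have sumG : \sum_(H in G) W (rk H) = \sum_(q <= s < k.+1) #|g s| * W s.
  rewrite (eq_bigr (fun H => \sum_(q <= s < k.+1) (rk H == s) * W s)).
    rewrite exchange_big /=; apply: eq_bigr => s _.
    rewrite -big_distrl /= -sum1_card big_mkcond [in RHS]big_mkcond.
    congr (_ * _); apply: eq_bigr => H _; rewrite inE.
    by case: (H \in G) => //; case: (rk H == s).
  move=> H HG; have /andP[_ Hk] := GP _ HG.
  rewrite (bigD1_seq (rk H)) ?iota_uniq ?mem_index_iota //=; last first.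
    by rewrite ltnS Hk andbT; apply: minG.
  rewrite eqxx mul1n big1 ?addn0 // => s /negbTE.
  by rewrite eq_sym => ->.
(* If [W t] vanished, so would [W s] for all ranks occurring in [G], and [A] would be empty. *)
have W_gt0 : 0 < W t.
  rewrite lt0n; apply: contraNneq A0 => W0; rewrite -cards_eq0 -leqn0.
  apply: leq_trans cA _; rewrite leqn0 sum_nat_eq0; apply/forall_inP => H HG.
  have /andP[_ Hk] := GP _ HG.
  have tH : t <= rk H by apply: leq_trans (ltnW tq) (minG _ HG).
  have := cW _ tH Hk; rewrite W0 leqn0 !muln_eq0 !expn_eq0 /=.
  by rewrite gtn_eqF // (ltnW c_gt1).
have cj : 2 * (q ^ 2) ^ t <= c ^ (q - t).
  have -> : q = t + (q - t.+1).+1 by rewrite -subSn // subSS subnKC // ltnW.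
  by rewrite addKn; apply: spread_constant.
(* Multiplying by [c ^ (k - t)] avoids division; the members of rank [s] then contribute at most
   [(q ^ 2) ^ t * W t * c ^ (k - s)]. *)
rewrite -(ltn_pmul2l (_ : 0 < c ^ (k - t))); last first.
  by rewrite expn_gt0 (ltnW c_gt1).
apply: leq_ltn_trans (leq_mul (leqnn _) cA) _; rewrite sumG big_distrr /=.
apply: leq_ltn_trans (_ : \sum_(q <= s < k.+1) (q ^ 2) ^ t * W t * c ^ (k - s) < _).
  rewrite big_nat_cond [leqRHS]big_nat_cond; apply: leq_sum => s; rewrite andbT ltnS.
  case/andP=> qs sk; have ts : t <= s by apply: leq_trans (ltnW tq) qs.
  have -> : k - t = (k - s) + (s - t) by rewrite addnBA // subnK.
  rewrite expnD -mulnA [leqRHS]mulnC leq_mul2l; apply/orP; right.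
  apply: leq_trans (_ : c ^ (s - t) * ((q ^ 2) ^ t * (r ^ (s - t) * W s)) <= _).
    by rewrite leq_mul2l mulnA leq_mul ?orbT.
  by rewrite mulnCA leq_mul2l cW ?orbT.
rewrite -big_distrr /=.
(* The geometric sum costs a factor 2, which [cj] absorbs together with [(q ^ 2) ^ t] into
   [c ^ (q - t)]. *)
apply: leq_trans (_ : (q ^ 2) ^ t * W t * (2 * c ^ (k - q)) <= _).
  rewrite ltn_pmul2l ?geometric_sum_lt // muln_gt0 W_gt0 !expn_gt0 andbT.
  by rewrite (leq_trans _ tq).
have -> : k - t = (q - t) + (k - q).
  by rewrite addnC addnBA ?subnK // ltnW.
rewrite expnD mulnCA mulnA [leqRHS]mulnAC leq_mul2r mulnA; apply/orP; right.
by rewrite leq_mul2r cj orbT.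
Qed.
End Bound.

(** * Return to the constants and the bracket of the theorem *)

Lemma leq_c_m t k b : c_ t * (m_ k + 1) <= b ->
  (t + 2) ^ (2 * t) * (2 * t)`! * (k ^ 2).+1 <= b.
Proof.
(* Hence [2 * (m_ k + 1) = k ^ 2 + k + 2], which is at least [(k ^ 2).+1]. *)
have mk : m_ k * 2 = k.+1 * k by rewrite /m_ -[2]/(2`!) bin_ffact ffactnS ffactn1.
apply: leq_trans; rewrite /c_; move: (_ ^ (2 * t)) (_`!) => D f.
rewrite -(mulnA 2) (mulnC 2) -(mulnA _ 2) leq_mul2l.
by apply/orP; right; lia.
Qed.

Lemma card_above_rank n k t (T : {set edge n}) : t < k -> k <= n ->
  T \in flats n t ->
  #|[set F in flats n k | T \subset F]| = bracket (n - t) (k - t).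
Proof.
move=> tk kn Tt; rewrite card_flats_above ?(flats_flat Tt) // ncE (rk_flats Tt).
by rewrite /bracket; congr stirling2; lia.
Qed.

Theorem theorem1p3 (n k t : nat) (A : {set {set edge n}})
  (ht : 1 <= t) (htk : t < k)
  (hn : n + 1 - k >= c_ t * (m_ k + 1))
  (hA : A \subset flats n k)
  (hint : t_intersecting t A) :
  #|A| <= bracket (n - t) (k - t) /\
  (#|A| = bracket (n - t) (k - t) <->
   exists2 T : {set edge n}, T \in flats n t &
     A = [set F in flats n k | T \subset F]).
Proof.
have [A0 /tintP tA] := hint.
(* The lower bound on the truncated difference [n + 1 - k] is positive. *)
have kn : k <= n.
  have : 0 < c_ t * (m_ k + 1) by rewrite addn1 !muln_gt0 expn_gt0 addn2 fact_gt0.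
  by move=> /leq_trans/(_ hn); rewrite addn1 subn_gt0.
rewrite (addn1 n) in hn.
have [[T Tt AT] | ltA] := nontrivial_bound ht kn (leq_c_m hn) hA A0 tA.
  (* Here [A] lies in the family of all rank-[k] flats above [T], whose size is the bound, so equal
     size forces equality. *)
  have sub : A \subset [set F in flats n k | T \subset F].
    by apply/subsetP => F FA; rewrite inE (subsetP hA) // AT.
  have cT := card_above_rank htk kn Tt.
  split; first by rewrite -cT subset_leq_card.
  split=> [cA | [T' T't ->]]; last exact: card_above_rank.
  by exists T => //; apply/eqP; rewrite eqEcard sub cT cA /=.
have E : stirling2 (n.+1 - t) (n.+1 - k) = bracket (n - t) (k - t).
  by rewrite /bracket; congr stirling2; lia.
rewrite E in ltA; split; first exact: ltnW.
(* The strict bound refutes both sides of the equivalence. *)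
split=> [cA | [T Tt AE]]; first by rewrite cA ltnn in ltA.
by rewrite AE (card_above_rank htk kn Tt) ltnn in ltA.
Qed.
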